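(* Let $w=(p,q)\in\mathbb R_{>0}^2$, $m(w)=\min\{p,q\}$, and let $\alpha_*\in\mathbb R_{>0}^2$ satisfy $\langle w,\alpha_*\rangle=2m(w)$. Assume that $w$ has been rescaled by a sufficiently large positive constant so that $\alpha_n:=\alpha_*-2^{-n}w/|w|^2\in\mathbb R_{\ge0}^2$ for all $n\ge1$. For $\beta>0$ put $$\mu_\beta=\frac1{Z_\beta}\sum_{n=1}^\infty 2^{-\beta n}\delta_{\alpha_n},\qquad Z_\beta=\sum_{n=1}^\infty2^{-\beta n}.$$ Let $0<\beta_-\le2<\beta_+$. Then the measures $\mu_{\beta_-}$ and $\mu_{\beta_+}$ have: (i) the same compact exponent support $E=\{\alpha_*\}\cup\{\alpha_n:n\ge1\}$; (ii) the same convex Newton body (convex hull of the support) and the same support function $v\mapsto\max_{\alpha\in E}\langle v,\alpha\rangle$; (iii) zero mass on the common exposed point $\alpha_*$; (iv) opposite critical radial behaviour: the curve $\gamma_w(r)=(r^p,r^q,z_0)$ has infinite $g_{\mu_{\beta_-}}$-length and finite $g_{\mu_{\beta_+}}$-length as $r\downarrow0$. Consequently, neither the closed exponent support, nor the convex Newton body, nor the support function determines whether weighted radial curves have finite length in the critical case $\max_{\alpha\in E}\langle w,\alpha\rangle=2m(w)$.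
   Context: Let $k\ge0$, let $V\subset\mathbb R^k$ be open, let $\varepsilon>0$, and let $U=[0,\varepsilon)^2\times V$ with coordinates $(x,y,z)$ (an adapted chart of a manifold with corners near the codimension-two corner stratum $\{x=y=0\}$), with $U^\circ=(0,\varepsilon)^2\times V$. Let $g_{\mathrm E}$ be the Euclidean metric and $g_0$ a smooth Riemannian metric on $U$ with $c_0g_{\mathrm E}\le g_0\le C_0g_{\mathrm E}$ for constants $0<c_0\le C_0<\infty$. For a finite nonzero positive Radon measure $\mu$ with compact support $E\subset\mathbb R_{\ge0}^2$, let $u:E\times U^\circ\to(0,\infty)$ be any jointly measurable coefficient with $0<c_u\le u(\alpha;x,y,z)\le C_u<\infty$ for $\mu$-almost every $\alpha\in E$ and every $(x,y,z)\in U^\circ$, such that $F_\mu(x,y,z)=\int_E u(\alpha;x,y,z)x^{-\alpha_1}y^{-\alpha_2}\,d\mu(\alpha)$ is continuous and positive on $U^\circ$; put $g_\mu=F_\mu g_0$. Here $z_0\in V$, and $\gamma_w$ is defined on $0<r<r_0$ with $r_0\in(0,1)$ small enough that $r_0^p,r_0^q<\varepsilon$. *)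

(* Defs.v *)
From HB Require Import structures.
From mathcomp Require Import all_boot all_order all_algebra.
From mathcomp Require Import all_classical all_reals all_analysis.

Set Implicit Arguments.
Unset Strict Implicit.
Unset Printing Implicit Defensive.

Import Order.TTheory GRing.Theory Num.Theory.
Import numFieldNormedType.Exports.

Local Open Scope classical_set_scope.
Local Open Scope ring_scope.

Section exponents.
Context {R : realType}.
Implicit Types (v w a : R * R) (A C : set (R * R)).

Definition dot v a : R := v.1 * a.1 + v.2 * a.2.

Definition min_weight w : R := Num.min w.1 w.2.

Definition quadrant : set (R * R) := [set a | 0 <= a.1 /\ 0 <= a.2].

(* Only used for nonempty compact A, where the supremum is a maximum. *)
Definition support_function A v : R := sup [set dot v a | a in A].

Definition convex_hull A : set (R * R) :=
  smallest (@convex_set R (R * R)%type) A.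

Definition exposed_point C a : Prop :=
  C a /\ exists v, forall b, C b -> b <> a -> dot v b < dot v a.

Definition msupport (mu : {measure set (R * R) -> \bar R}) : set (R * R) :=
  [set a | forall O : set (R * R), open O -> O a -> (0 < mu O)%E].

Definition newton_body (mu : {measure set (R * R) -> \bar R}) : set (R * R) :=
  convex_hull (msupport mu).

(* The measurable sets of R * R are the Borel sets of the plane, and every
   finite Borel measure on the plane is Radon. *)
Definition exponent_measure (mu : {measure set (R * R) -> \bar R}) : Prop :=
  [/\ (0 < mu setT)%E, (mu setT < +oo)%E, compact (msupport mu)
    & msupport mu `<=` quadrant].

Definition alpha_seq w astar (n : nat) : R * R :=
  (astar.1 - 2 ^- n * w.1 / dot w w, astar.2 - 2 ^- n * w.2 / dot w w).

Definition exponent_set w astar : set (R * R) :=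
  [set astar] `|` [set alpha_seq w astar n | n in [set n | (1 <= n)%N]].

Definition geom_weight (beta : R) (n : nat) : R := 2 `^ (- (beta * n%:R)).

Definition geom_mass (beta : R) : R :=
  fine (\sum_(1 <= n <oo) (geom_weight beta n)%:E)%E.

Lemma geom_weight_ge0 beta n : 0 <= geom_weight beta n.
Proof. exact: powR_ge0. Qed.

Lemma geom_mass_inv_ge0 beta : 0 <= (geom_mass beta)^-1.
Proof.
rewrite invr_ge0 fine_ge0//; apply: nneseries_ge0 => n _ _.
by rewrite lee_fin geom_weight_ge0.
Qed.

Definition mu_beta w astar (beta : R) : {measure set (R * R) -> \bar R} :=
  mscale (NngNum (geom_mass_inv_ge0 beta))
    (mseries (fun n => mscale (NngNum (geom_weight_ge0 beta n))
                              (dirac (alpha_seq w astar n))) 1).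

End exponents.

Section smoothness.
Context {R : realType} {n : nat}.
Implicit Types (f : 'rV[R]_n -> R) (O A : set 'rV[R]_n).

Definition partial (i : 'I_n) f : 'rV[R]_n -> R :=
  fun p => 'D_(delta_mx 0 i : 'rV[R]_n) f p.

Definition smooth_on_open O f : Prop :=
  forall (s : seq 'I_n) p, O p ->
    {for p, continuous (foldr partial f s)} /\
    forall i, derivable (foldr partial f s) p (delta_mx 0 i : 'rV[R]_n).

(* Smoothness on a set with boundary or corners: local smooth extendability. *)
Definition smooth_on A f : Prop :=
  forall p, A p -> exists (O : set 'rV[R]_n) (h : 'rV[R]_n -> R),
    [/\ open O, O p, smooth_on_open O h & {in O `&` A, h =1 f}].

End smoothness.

Section corner_chart.
Context {R : realType} {k : nat}.

(* A point (x, y, z) of R^2 x R^k is a row vector of length 2 + k. *)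
Definition chart_point (x y : R) (z : 'rV[R]_k) : 'rV[R]_(2 + k) :=
  row_mx (\row_(i < 2) if i == 0 then x else y) z.

Definition xcoord (p : 'rV[R]_(2 + k)) : R := lsubmx p 0 0.
Definition ycoord (p : 'rV[R]_(2 + k)) : R := lsubmx p 0 1.
Definition zcoord (p : 'rV[R]_(2 + k)) : 'rV[R]_k := rsubmx p.

Definition corner_chart (eps : R) (V : set 'rV[R]_k) : set 'rV[R]_(2 + k) :=
  [set p | [/\ 0 <= xcoord p < eps, 0 <= ycoord p < eps & V (zcoord p)]].

Definition chart_interior (eps : R) (V : set 'rV[R]_k) :
    set 'rV[R]_(2 + k) :=
  [set p | [/\ 0 < xcoord p < eps, 0 < ycoord p < eps & V (zcoord p)]].

Definition gform {n} (G : 'M[R]_n) (v : 'rV[R]_n) : R := (v *m G *m v^T) 0 0.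

Definition euclidean_metric {n} (p : 'rV[R]_n) : 'M[R]_n := 1%:M.

Definition riemannian_metric {n} (A : set 'rV[R]_n)
    (g : 'rV[R]_n -> 'M[R]_n) : Prop :=
  [/\ forall i j, smooth_on A (fun p => g p i j),
      forall p, A p -> (g p)^T = g p
    & forall p v, A p -> v != 0 -> 0 < gform (g p) v].

Definition metric_le {n} (A : set 'rV[R]_n) (g h : 'rV[R]_n -> 'M[R]_n) : Prop :=
  forall p v, A p -> gform (g p) v <= gform (h p) v.

Definition density (mu : {measure set (R * R) -> \bar R})
    (u : R * R -> 'rV[R]_(2 + k) -> R) (p : 'rV[R]_(2 + k)) : R :=
  \int[mu]_(a in msupport mu)
    (u a p * (xcoord p `^ (- a.1) * ycoord p `^ (- a.2))).

(* Joint measurability is with respect to the product of the Borel sigma-algebra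
   of the plane and the Borel sigma-algebra of R^(2 + k). *)
Definition admissible (eps : R) (V : set 'rV[R]_k)
    (mu : {measure set (R * R) -> \bar R})
    (u : R * R -> 'rV[R]_(2 + k) -> R) : Prop :=
  [/\ measurable_fun
        (msupport mu `*` chart_interior eps V :
           set ((R * R) * g_sigma_algebraType (@open 'rV[R]_(2 + k))))
        (fun q => u q.1 q.2),
      forall a p, msupport mu a -> chart_interior eps V p -> 0 < u a p,
      exists cu Cu : R, 0 < cu /\
        {ae mu, forall a, msupport mu a ->
           forall p, chart_interior eps V p -> cu <= u a p <= Cu}
    & forall p, chart_interior eps V p ->
        {for p, continuous (density mu u)} /\ 0 < density mu u p].

Definition weighted_metric (mu : {measure set (R * R) -> \bar R})
    (u : R * R -> 'rV[R]_(2 + k) -> R)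
    (g0 : 'rV[R]_(2 + k) -> 'M[R]_(2 + k)) (p : 'rV[R]_(2 + k)) :
    'M[R]_(2 + k) := density mu u p *: g0 p.

Definition curve_length {n} (g : 'rV[R]_n -> 'M[R]_n) (gam : R -> 'rV[R]_n)
    (r0 : R) : \bar R :=
  (\int[lebesgue_measure]_(r in `]0%R, r0[)
     (Num.sqrt (gform (g (gam r)) (derive1 gam r)))%:E)%E.

Definition radial_curve (w : R * R) (z0 : 'rV[R]_k) (r : R) :
    'rV[R]_(2 + k) := chart_point (r `^ w.1) (r `^ w.2) z0.

Definition radial_length (mu : {measure set (R * R) -> \bar R})
    (u : R * R -> 'rV[R]_(2 + k) -> R)
    (g0 : 'rV[R]_(2 + k) -> 'M[R]_(2 + k)) (w : R * R) (z0 : 'rV[R]_k)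
    (r0 : R) : \bar R :=
  curve_length (weighted_metric mu u g0) (radial_curve w z0) r0.

(* In the fixed chart, for the fixed weight w and base point z0, finiteness of
   the radial length in the critical case is a function of the invariant inv
   of the measure alone. *)
Definition determines_critical_finiteness (eps : R) (V : set 'rV[R]_k)
    (g0 : 'rV[R]_(2 + k) -> 'M[R]_(2 + k)) (w : R * R) (z0 : 'rV[R]_k)
    (r0 : R) (T : Type) (inv : {measure set (R * R) -> \bar R} -> T) : Prop :=
  exists Phi : T -> Prop,
    forall (mu : {measure set (R * R) -> \bar R})
           (u : R * R -> 'rV[R]_(2 + k) -> R),
      exponent_measure mu -> admissible eps V mu u ->
      support_function (msupport mu) w = 2 * min_weight w ->
      ((radial_length mu u g0 w z0 r0 < +oo)%E <-> Phi (inv mu)).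

End corner_chart.

(* Main.v *)
(* Along gamma(r) = (r^p, r^q, z0), put L = -ln r.  The criticality condition
   <w, alpha_*> = 2 m(w) makes the monomial of alpha_n equal to
   r^(-2 m(w)) exp(-L 2^-n), while the squared Euclidean speed of gamma is
   comparable to r^(2 m(w) - 2).  So the g_mu-speed is comparable to
   (1/r) sqrt(S(L)) with S(L) = sum_n 2^(-beta n) exp(-L 2^-n).
   If beta <= 2, the single term with 2^n <= L < 2^(n+1) gives
   S(L) >= e^-2 L^-2, and dr / (r L) has infinite integral near 0.
   If beta > 2, pick 2 < s < beta: from exp(-t) <= C_s t^-s, applied term by
   term, S(L) <= C L^-s, and dr / (r L^(s/2)) is integrable near 0.
   The constant coefficient u = 1 is admissible, so the two measures also show
   that no invariant on which they agree decides finiteness. *)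
Require Import Defs.
From mathcomp Require Import all_boot all_order all_algebra.
From mathcomp Require Import all_classical all_reals all_analysis.
From mathcomp Require Import measurable_realfun.
From mathcomp Require Import ring lra.

Set Implicit Arguments.
Unset Strict Implicit.
Unset Printing Implicit Defensive.

Import Order.TTheory GRing.Theory Num.Theory.
Import numFieldNormedType.Exports.

Local Open Scope classical_set_scope.
Local Open Scope ring_scope.

(* No measurability is needed: the integral of a nonnegative function is a
   supremum over the simple functions below it. *)
Lemma ge0_le_subset_integral d (T : measurableType d) (R : realType)
    (mu : {measure set T -> \bar R}) (A B : set T) (f g : T -> \bar R) :
  A `<=` B -> (forall x, A x -> 0 <= f x)%E -> (forall x, B x -> 0 <= g x)%E ->
  (forall x, A x -> f x <= g x)%E ->
  (\int[mu]_(x in A) f x <= \int[mu]_(x in B) g x)%E.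
Proof.
move=> AB f0 g0 fg; rewrite !ge0_integralE//.
apply: ereal_sup_le => _ [h hf <-]; exists h => //= x.
apply: (le_trans (hf x)); rewrite !patchE.
case: ifPn => [/set_mem Ax|_]; first by rewrite (mem_set (AB _ Ax)) fg.
by case: ifPn => // /set_mem; exact: g0.
Qed.

Lemma nneseries_gt0 (R : realType) (u : nat -> \bar R) (n : nat) :
  (forall i, 0 <= u i)%E -> (0 < u n)%E -> (0 < \sum_(i <oo) u i)%E.
Proof.
move=> u0 un; apply: lt_le_trans (nneseries_lim_ge n.+1 _); last by [].
rewrite big_nat_recr//=; apply: lt_le_trans un _.
by rewrite leeDr// sume_ge0.
Qed.

(** * Geometric weights and the normalising constant *)

Section geometric_weights.
Context {R : realType}.
Implicit Types (w a astar : R * R) (beta : R).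

Lemma geom_weightS beta n :
  geom_weight beta n.+1 = (2 `^ (- beta)) * (2 `^ (- beta)) ^+ n.
Proof.
by rewrite /geom_weight -mulNr powRrM powR_mulrn ?powR_ge0// exprS.
Qed.

Lemma geom_weight_gt0 beta n : 0 < geom_weight beta n.
Proof. by rewrite powR_gt0. Qed.

Lemma geom_series_lty beta : 0 < beta ->
  (\sum_(n <oo) (geom_weight beta n.+1)%:E < +oo)%E.
Proof.
move=> b0; set q : R := 2 `^ (- beta).
have q0 : 0 < q by rewrite powR_gt0.
have q1 : `|q| < 1.
  rewrite gtr0_norm// /q powRN invf_lt1 ?powR_gt0//.
  by rewrite -[ltLHS](powRr0 2) /powR !gt_eqF// ltr_expR mul0r mulr_gt0// ln_gt0// ltr1n.
(* The sum starts at the exponent [n.+1], hence the extra factor [q] in the numerator. *)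
rewrite (_ : (\sum_(n <oo) _)%E = (q / (1 - q))%:E) ?ltry//.
have /cvg_lim <- // : EFin \o series (geometric q q) @ \oo --> (q / (1 - q))%:E.
  by apply: cvg_EFin; [exact: nearW|exact: cvg_geometric_series].
congr (limn _); apply/funext => n.
rewrite /series/= big_mkord -sumEFin big_mkord.
by apply: eq_bigr => i _; rewrite geom_weightS.
Qed.

(** Convergence of the series ensures that [fine] keeps its value; the index is shifted so that all
    later sums start at 0. *)
Lemma geom_massE beta : 0 < beta ->
  (geom_mass beta)%:E = (\sum_(n <oo) (geom_weight beta n.+1)%:E)%E.
Proof.
move=> b0; rewrite /geom_mass -(@nneseries_addn _ (fun n => (geom_weight beta n)%:E) 1).
  under eq_eseriesr do rewrite addn1.
  rewrite fineK// ge0_fin_numE ?geom_series_lty//.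
  by apply: nneseries_ge0 => n _ _; rewrite lee_fin geom_weight_ge0.
by move=> i; rewrite lee_fin geom_weight_ge0.
Qed.

Lemma geom_mass_gt0 beta : 0 < beta -> 0 < geom_mass beta.
Proof.
move=> b0; rewrite -lte_fin geom_massE//; apply: (@nneseries_gt0 _ _ 0%N) => [i|];
  by rewrite ?lee_fin ?lte_fin ?geom_weight_ge0 ?geom_weight_gt0.
Qed.

Lemma mu_betaE w astar beta (A : set (R * R)) :
  mu_beta w astar beta A = ((geom_mass beta)^-1%:E *
    \sum_(n <oo) (geom_weight beta n.+1)%:E * \d_(alpha_seq w astar n.+1) A)%E.
Proof.
rewrite /mu_beta /mscale/= /mseries; congr (_ * _)%E.
pose F n := (mscale (NngNum (geom_weight_ge0 beta n)) \d_(alpha_seq w astar n) A : \bar R).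
rewrite -[LHS]/(\sum_(1 <= i <oo) F i)%E.
rewrite -(@nneseries_addn _ F 1); last by move=> i; exact: measure_ge0.
by apply: eq_eseriesr => n _; rewrite addn1.
Qed.

End geometric_weights.

(** * The exponent set, its convex hull, and the measures carried by it *)

Section exponent_set.
Context {R : realType}.
Implicit Types (w a b v astar : R * R) (beta : R).

Lemma dot_self_gt0 w : 0 < w.1 -> 0 < w.2 -> 0 < dot w w.
Proof. by move=> w1 w2; rewrite addr_gt0 ?mulr_gt0. Qed.

Lemma dot_alpha_seq w astar n : dot w w != 0 ->
  dot w (alpha_seq w astar n) = dot w astar - 2 ^- n.
Proof. by rewrite /alpha_seq /dot/= => ww; field; rewrite ww expf_neq0. Qed.

Lemma exponent_setP w astar a : exponent_set w astar a ->
  a = astar \/ exists n, a = alpha_seq w astar n.+1.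
Proof.
case=> [->|[[|n]// _ <-]]; first by left.
by right; exists n.
Qed.

Lemma alpha_seq_exponent_set w astar n :
  exponent_set w astar (alpha_seq w astar n.+1).
Proof. by right; exists n.+1. Qed.

Lemma alpha_seq_neq w astar n : dot w w != 0 -> alpha_seq w astar n <> astar.
Proof.
move=> ww eq_a; have := dot_alpha_seq astar n ww; rewrite eq_a.
by move/eqP; rewrite eq_sym addrC -subr_eq0 addrK oppr_eq0 invr_eq0 expf_eq0 pnatr_eq0 andbF.
Qed.

Lemma cvg_alpha_seq w astar : alpha_seq w astar n @[n --> \oo] --> astar.
Proof.
have h (x y : R) : x - 2 ^- n * y / dot w w @[n --> \oo] --> x.
  rewrite -[X in _ --> X]subr0; apply: cvgB; first exact: cvg_cst.
  rewrite -[X in _ --> X](mul0r (y / dot w w)).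
  under eq_fun do rewrite -mulrA; apply: cvgM; last exact: cvg_cst.
  rewrite (_ : (fun n => _) = geometric 1 (2^-1)).
    by apply: cvg_geometric; rewrite ger0_norm ?invr_ge0// invf_lt1// ltr1n.
  by apply/funext => n; rewrite /= mul1r exprVn.
by rewrite [X in _ --> X]surjective_pairing; exact: (cvg_pair (h _ _) (h _ _)).
Qed.

(** Suppose [astar] is not a cluster point of the filter. Then some neighbourhood [B] of [astar]
    misses a member of the filter. Since [B] contains a tail of the sequence, the filter lives on
    the finite set [G], which is compact. *)
Lemma compact_exponent_set w astar : compact (exponent_set w astar).
Proof.
move=> F FF FE.
have [clF|/existsNP[A /existsNP[B /not_implyP[FA /not_implyP[nB AB]]]]] :=
  pselect (cluster F astar).
  by exists astar; split => //; left.
have /(_ _ nB)[N _ NB] := @cvg_alpha_seq w astar.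
pose G := [set alpha_seq w astar n | n in [set n | (1 <= n < N)%N]].
have cG : compact G.
  apply: finite_compact; apply: finite_image.
  by apply: sub_finite_set (finite_II N) => n /andP[].
have FG : F G.
  apply: filterS (filterI FE FA) => a [Ea Aa].
  have nBa : ~ B a by move=> Ba; apply: AB; exists a.
  case: Ea => [eq_a|[n n1 eq_a]].
    by exfalso; apply: nBa; rewrite eq_a; exact: nbhs_singleton.
  exists n => //=; rewrite (_ : (1 <= n)%N)//= ltnNge; apply/negP => Nn.
  by apply: nBa; rewrite -eq_a; exact: NB.
have [a [[n /andP[n1 _] <-] clFa]] := cG _ FF FG.
by exists (alpha_seq w astar n); split => //; right; exists n.
Qed.

Lemma closed_exponent_set w astar : closed (exponent_set w astar).
Proof. by apply: compact_closed; [exact: norm_hausdorff|exact: compact_exponent_set]. Qed.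

Lemma countable_exponent_set w astar : countable (exponent_set w astar).
Proof.
pose f n := if n is n'.+1 then alpha_seq w astar n'.+1 else astar.
suff Ef : exponent_set w astar `<=` range f.
  apply: sub_countable (subset_card_le Ef) _.
  by apply: sub_countable (card_image_le _ _) _; exact: countableP.
by move=> _ /exponent_setP[->|[n ->]]; [exists 0%N|exists n.+1].
Qed.

Lemma measurable_prod_set1 a : measurable [set a].
Proof.
rewrite (_ : [set a] = [set a.1] `*` [set a.2]); first exact: measurableX.
by apply/seteqP; split => [b ->//|[b1 b2] /= [-> ->]]; case: a.
Qed.

(** Points are measurable and the set is countable, so every function on it is measurable. *)
Lemma measurable_sub_exponent_set w astar (A : set (R * R)) :
  A `<=` exponent_set w astar -> measurable A.
Proof.
move=> AE; apply: countable_measurable; first exact: measurable_prod_set1.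
exact: sub_countable (subset_card_le AE) (countable_exponent_set w astar).
Qed.

Lemma measurable_fun_exponent_set w astar d (T : measurableType d)
    (f : R * R -> T) : measurable_fun (exponent_set w astar) f.
Proof. by move=> _ B _; apply: (@measurable_sub_exponent_set w astar); exact: subIsetl. Qed.

(** The point [astar] together with the open half-plane where [dot w] is below [dot w astar] is
    convex and contains the exponent set, hence its hull. Thus [w] itself exposes [astar]. *)
Lemma exponent_set_convex_hull_dot w astar b : dot w w != 0 ->
  convex_hull (exponent_set w astar) b -> b <> astar -> dot w b < dot w astar.
Proof.
move=> ww; pose H := [set b | b = astar \/ dot w b < dot w astar].
suff /(_ b) h : convex_hull (exponent_set w astar) `<=` H.
  by move=> /h[->|].
apply: smallest_sub => /=; last first.
  move=> _ /exponent_setP[->|[n ->]]; first by left.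
  by right; rewrite dot_alpha_seq// ltrBlDr ltrDl invr_gt0 exprn_gt0.
apply/convex_setW => x y /set_mem Hx /set_mem Hy k k0 k1; apply/mem_set.
have dotk : dot w (conv k x y) = k%:num * dot w x + (1 - k%:num) * dot w y.
  by rewrite /conv/= /dot/= /GRing.scale/= /unstable.onem; ring.
(* If both points are [astar], so is the combination. Otherwise one of them lies strictly below and
   has a positive coefficient. *)
case: Hx Hy dotk => [-> | dx] [->|dy] dotk; first by left; rewrite convmm.
all: by right; rewrite dotk; nra.
Qed.

Lemma exposed_point_exponent_set w astar : dot w w != 0 ->
  exposed_point (convex_hull (exponent_set w astar)) astar.
Proof.
move=> ww; split; first by apply: sub_gen_smallest; left.
by exists w => b hb bn; exact: exponent_set_convex_hull_dot hb bn.
Qed.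

Lemma support_function_exponent_set w astar : dot w w != 0 ->
  support_function (exponent_set w astar) w = dot w astar.
Proof.
move=> ww; rewrite /support_function.
have ub : ubound [set dot w a | a in exponent_set w astar] (dot w astar).
  move=> _ [_ /exponent_setP[->|[n ->]] <-]//.
  by rewrite dot_alpha_seq// lerBlDr lerDl invr_ge0 exprn_ge0.
have ne : [set dot w a | a in exponent_set w astar] (dot w astar).
  by exists astar => //; left.
apply/eqP; rewrite eq_le; apply/andP; split.
  by apply: ge_sup => //; exists (dot w astar).
by apply: ub_le_sup => //; exists (dot w astar).
Qed.

Lemma exponent_set_quadrant w astar : 0 < astar.1 -> 0 < astar.2 ->
  (forall n, (1 <= n)%N -> quadrant (alpha_seq w astar n)) ->
  exponent_set w astar `<=` quadrant.
Proof.
by move=> a1 a2 q _ [->|[n n1 <-]]; [split; exact: ltW|exact: q].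
Qed.

Lemma alpha_seq_le w astar n : 0 < w.1 -> 0 < w.2 ->
  (alpha_seq w astar n).1 <= astar.1 /\ (alpha_seq w astar n).2 <= astar.2.
Proof.
move=> w1 w2; have ww := dot_self_gt0 w1 w2.
by split; rewrite lerBlDr lerDl divr_ge0 ?(ltW ww)// mulr_ge0 ?invr_ge0 ?exprn_ge0 ?ltW.
Qed.

Lemma mu_beta_gt0 w astar beta (A : set (R * R)) n : 0 < beta ->
  A (alpha_seq w astar n.+1) -> (0 < mu_beta w astar beta A)%E.
Proof.
move=> b0 An; rewrite mu_betaE mule_gt0// ?lte_fin ?invr_gt0 ?geom_mass_gt0//.
apply: (@nneseries_gt0 _ _ n) => [i|].
  by rewrite mule_ge0// lee_fin geom_weight_ge0.
by rewrite diracE mem_set// mule1 lte_fin geom_weight_gt0.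
Qed.

Lemma mu_beta_eq0 w astar beta (A : set (R * R)) :
  (forall n, ~ A (alpha_seq w astar n.+1)) -> mu_beta w astar beta A = 0%E.
Proof.
move=> nA; rewrite mu_betaE eseries0 ?mule0// => n _ _.
by rewrite diracE memNset// mule0.
Qed.

Lemma mu_betaT w astar beta : 0 < beta -> mu_beta w astar beta setT = 1%E.
Proof.
move=> b0; rewrite mu_betaE; under eq_eseriesr do rewrite diracT mule1.
by rewrite -geom_massE// -EFinM mulVf// gt_eqF// geom_mass_gt0.
Qed.

(** The complement of the closed exponent set is open and carries no atom. Conversely, every
    neighbourhood of [astar] contains a tail of atoms, so [astar] is in the support although it has
    no mass. *)
Lemma msupport_mu_beta w astar beta : 0 < beta ->
  msupport (mu_beta w astar beta) = exponent_set w astar.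
Proof.
move=> b0; apply/seteqP; split => [a sa|a /exponent_setP[->|[n ->]] O oO Oa].
- apply: contrapT => nEa.
  have := sa _ (closed_openC (@closed_exponent_set w astar)) nEa.
  rewrite mu_beta_eq0 ?ltxx// => n; apply.
  exact: alpha_seq_exponent_set.
- have /(_ _ (open_nbhs_nbhs (conj oO Oa)))[N _ NO] := @cvg_alpha_seq w astar.
  by apply: (@mu_beta_gt0 _ _ _ _ N) => //; apply: NO => /=.
- exact: (@mu_beta_gt0 _ _ _ _ n).
Qed.

Lemma exponent_measure_mu_beta w astar beta : 0 < beta ->
  0 < astar.1 -> 0 < astar.2 ->
  (forall n, (1 <= n)%N -> quadrant (alpha_seq w astar n)) ->
  exponent_measure (mu_beta w astar beta).
Proof.
move=> b0 a1 a2 q; rewrite /exponent_measure mu_betaT// msupport_mu_beta//.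
split; rewrite ?lte01 ?ltry//; first exact: compact_exponent_set.
exact: exponent_set_quadrant.
Qed.

(** Each [alpha_seq w astar n.+1] has positive mass, so it cannot lie in a null set. This turns
    almost everywhere bounds on [u] into bounds at every atom. *)
Lemma mu_beta_ae w astar beta (P : R * R -> Prop) n : 0 < beta ->
  {ae mu_beta w astar beta, forall a, P a} -> P (alpha_seq w astar n.+1).
Proof.
move=> b0 [N [mN N0 PN]]; apply: contrapT => /PN /(mu_beta_gt0 b0).
by rewrite N0 ltxx.
Qed.

Lemma ge0_integral_mu_beta w astar beta (f : R * R -> \bar R) : 0 < beta ->
  (forall a, exponent_set w astar a -> (0 <= f a)%E) ->
  (\int[mu_beta w astar beta]_(a in exponent_set w astar) f a =
   (geom_mass beta)^-1%:E *
     \sum_(n <oo) (geom_weight beta n.+1)%:E * f (alpha_seq w astar n.+1))%E.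
Proof.
move=> b0 f0; set E := exponent_set w astar.
have mE : measurable E by exact: (@measurable_sub_exponent_set w astar).
have mf : measurable_fun E f by exact: measurable_fun_exponent_set.
pose m_ n := mscale (NngNum (geom_weight_ge0 beta n.+1)) (dirac (alpha_seq w astar n.+1)).
(* The same measure, written as a series indexed from 0 over which the integral distributes. *)
transitivity (\int[mscale (NngNum (geom_mass_inv_ge0 beta))
    (mseries m_ 0)]_(a in E) f a)%E.
  apply: eq_measure_integral => A _ _; rewrite mu_betaE.
  by [].
rewrite ge0_integral_mscale//= ge0_integral_measure_series//; congr (_ * _)%E.
apply: eq_eseriesr => n _; rewrite ge0_integral_mscale//= integral_dirac//.
by rewrite diracE mem_set ?mul1e//; exact: alpha_seq_exponent_set.
Qed.

End exponent_set.

(** * Positivity and continuity of the density for the coefficient 1 *)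

Section density.
Context {R : realType} {k : nat}.
Implicit Types (w a astar : R * R) (beta : R) (p q : 'rV[R]_(2 + k)).

Lemma monomialE (x y : R) a : 0 < x -> 0 < y ->
  x `^ (- a.1) * y `^ (- a.2) = expR (- (a.1 * ln x + a.2 * ln y)).
Proof.
by move=> x0 y0; rewrite /powR !gt_eqF// -expRD opprD !mulNr.
Qed.

(** A weighted l1 distance in the coordinates [ln x], [ln y]. It controls the logarithm of all
    monomials with exponents between 0 and [astar] at once. *)
Definition log_distance astar p q : R :=
  astar.1 * `|ln (xcoord p) - ln (xcoord q)| +
  astar.2 * `|ln (ycoord p) - ln (ycoord q)|.

(** After taking logarithms this is linear in [a]. The factor depends on [astar] only, which makes
    the bound uniform over the exponent set. *)
Lemma monomial_ratio a astar p q :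
  0 <= a.1 <= astar.1 -> 0 <= a.2 <= astar.2 ->
  0 < xcoord p -> 0 < ycoord p -> 0 < xcoord q -> 0 < ycoord q ->
  xcoord p `^ (- a.1) * ycoord p `^ (- a.2) <=
  expR (log_distance astar p q) * (xcoord q `^ (- a.1) * ycoord q `^ (- a.2)).
Proof.
move=> /andP[a10 a1] /andP[a20 a2] xp yp xq yq.
rewrite !monomialE// -expRD ler_expR /log_distance.
have key (b c s t : R) : 0 <= b -> b <= c -> b * (t - s) <= c * `|s - t|.
  move=> b0 bc; rewrite distrC (le_trans (ler_wpM2l b0 (ler_norm _)))//.
  by rewrite ler_wpM2r.
have := key _ _ (ln (xcoord p)) (ln (xcoord q)) a10 a1.
have := key _ _ (ln (ycoord p)) (ln (ycoord q)) a20 a2.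
lra.
Qed.

Lemma xcoord_chart_point (x y : R) (z : 'rV[R]_k) : xcoord (chart_point x y z) = x.
Proof. by rewrite /xcoord row_mxKl mxE. Qed.

Lemma ycoord_chart_point (x y : R) (z : 'rV[R]_k) : ycoord (chart_point x y z) = y.
Proof. by rewrite /ycoord row_mxKl mxE. Qed.

Lemma zcoord_chart_point (x y : R) (z : 'rV[R]_k) : zcoord (chart_point x y z) = z.
Proof. by rewrite /zcoord row_mxKr. Qed.

Lemma continuous_xcoord : continuous (@xcoord R k).
Proof.
rewrite (_ : @xcoord R k = (fun p => p 0 (lshift k 0))); first exact: coord_continuous.
by apply/funext => p; rewrite /xcoord mxE.
Qed.

Lemma continuous_ycoord : continuous (@ycoord R k).
Proof.
rewrite (_ : @ycoord R k = (fun p => p 0 (lshift k 1))); first exact: coord_continuous.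
by apply/funext => p; rewrite /ycoord mxE.
Qed.

Lemma cvg_log_distance astar (F : set_system 'rV[R]_(2 + k)) q : Filter F ->
  0 < xcoord q -> 0 < ycoord q ->
  xcoord p @[p --> F] --> xcoord q -> ycoord p @[p --> F] --> ycoord q ->
  log_distance astar p q @[p --> F] --> 0.
Proof.
move=> FF xq yq /(cvg_comp _ _)/(_ (continuous_ln xq)) cx.
move=> /(cvg_comp _ _)/(_ (continuous_ln yq)) cy.
have key (c t : R) (f : 'rV[R]_(2 + k) -> R) : f p @[p --> F] --> t ->
    c * `|f p - t| @[p --> F] --> 0.
  move=> ft; rewrite -[X in _ --> X](mulr0 c) -(normr0 R) -(subrr t).
  apply: cvgM; first exact: cvg_cst.
  by apply: cvg_norm; apply: cvgB ft _; exact: cvg_cst.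
by rewrite -[X in _ --> X](addr0 0); apply: cvgD; exact: key.
Qed.

Section unit_coefficient.
Variables (w astar : R * R) (beta : R).
Hypotheses (w1 : 0 < w.1) (w2 : 0 < w.2) (b0 : 0 < beta).
Hypothesis quad : exponent_set w astar `<=` quadrant.

Let mu := mu_beta w astar beta.
Let E := exponent_set w astar.
Let mono p a := xcoord p `^ (- a.1) * ycoord p `^ (- a.2).
Let I p := (\int[mu]_(a in E) (mono p a)%:E)%E.

Let E_le a : E a -> (0 <= a.1 <= astar.1) /\ (0 <= a.2 <= astar.2).
Proof.
move=> Ea; have [-> ->] := quad Ea.
case/exponent_setP: Ea => [->|[n ->]]; first by rewrite !lexx.
by have [-> ->] := @alpha_seq_le _ w astar n.+1 w1 w2.
Qed.

Let mono_ge0 p a : 0 <= mono p a.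
Proof. by rewrite mulr_ge0 ?powR_ge0. Qed.

(** A Harnack-type inequality: the factor in [monomial_ratio] is the same for all exponents, so it
    survives integration. *)
Let le_I p q : 0 < xcoord p -> 0 < ycoord p -> 0 < xcoord q -> 0 < ycoord q ->
  (I p <= (expR (log_distance astar p q))%:E * I q)%E.
Proof.
move=> xp yp xq yq; rewrite /I -ge0_integralZl//.
- apply: ge0_le_subset_integral => // a Ea.
  + by rewrite lee_fin.
  + by rewrite mule_ge0 ?lee_fin ?expR_ge0.
  + by have [h1 h2] := E_le Ea; rewrite -EFinM lee_fin; exact: monomial_ratio.
- exact: (@measurable_sub_exponent_set _ w astar).
- exact: measurable_fun_exponent_set.
- by move=> a _; rewrite lee_fin.
Qed.

Let integral_E1 : (\int[mu]_(a in E) 1%:E = 1)%E.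
Proof.
rewrite ge0_integral_mu_beta//; under eq_eseriesr do rewrite mule1.
by rewrite -geom_massE// -EFinM mulVf// gt_eqF// geom_mass_gt0.
Qed.

Let unit_point : 'rV[R]_(2 + k) := chart_point 1 1 0.

Let I_unit : I unit_point = 1%E.
Proof.
rewrite -[RHS]integral_E1; apply: eq_integral => a _.
by rewrite /mono xcoord_chart_point ycoord_chart_point !powR1 mulr1.
Qed.

(** Every monomial equals 1 at [unit_point], where the integral is therefore 1. Comparing with this
    point in one direction gives positivity, in the other finiteness. *)
Let I_pos_fin p : 0 < xcoord p -> 0 < ycoord p -> (0 < I p < +oo)%E.
Proof.
move=> xp yp; apply/andP; split.
  have := @le_I unit_point p; rewrite I_unit xcoord_chart_point ycoord_chart_point.
  move=> /(_ ltr01 ltr01 xp yp); case: (I p) => [r| |]//=.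
    rewrite -EFinM lee_fin lte_fin => h.
    rewrite -(pmulr_rgt0 _ (expR_gt0 (log_distance astar unit_point p))).
    exact: lt_le_trans h.
  by rewrite gt0_muleNy ?lte_fin ?expR_gt0.
have := @le_I p unit_point; rewrite I_unit xcoord_chart_point ycoord_chart_point mule1.
by move=> /(_ xp yp ltr01 ltr01) /le_lt_trans; apply; exact: ltry.
Qed.

Let density1E p : density mu (fun _ _ => 1) p = fine (I p).
Proof.
rewrite /density /Rintegral msupport_mu_beta//; congr fine.
by apply: eq_integral => a _; rewrite mul1r.
Qed.

Lemma density_unit_gt0 p : 0 < xcoord p -> 0 < ycoord p ->
  0 < density mu (fun _ _ => 1) p.
Proof.
by move=> xp yp; rewrite density1E fine_gt0// I_pos_fin.
Qed.

Lemma density_unit_ratio p q : 0 < xcoord p -> 0 < ycoord p ->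
  0 < xcoord q -> 0 < ycoord q ->
  density mu (fun _ _ => 1) p <=
  expR (log_distance astar p q) * density mu (fun _ _ => 1) q.
Proof.
move=> xp yp xq yq; rewrite (density1E p) (density1E q).
have := I_pos_fin xp yp; have := I_pos_fin xq yq; have := le_I xp yp xq yq.
by move: (I p) (I q) => [x| |] [y| |]; rewrite ?ltxx ?andbF.
Qed.

(** The ratio bound, used in both directions, squeezes the density at [p] between its value at [q]
    times [expR] of minus and plus the log distance, which tends to 0. *)
Lemma cvg_density_unit (F : set_system 'rV[R]_(2 + k)) q : Filter F ->
  0 < xcoord q -> 0 < ycoord q ->
  xcoord p @[p --> F] --> xcoord q -> ycoord p @[p --> F] --> ycoord q ->
  density mu (fun _ _ => 1) p @[p --> F] --> density mu (fun _ _ => 1) q.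
Proof.
move=> FF xq yq cx cy; set h := density mu _.
have cD := cvg_log_distance astar FF xq yq cx cy.
have scaled (f : 'rV[R]_(2 + k) -> R) : f p @[p --> F] --> 0 ->
    expR (f p) * h q @[p --> F] --> h q.
  move=> f0; rewrite -[X in _ --> X]mul1r -expR0.
  by apply: cvgM (cvg_comp _ _ f0 (@continuous_expR R _)) _; exact: cvg_cst.
have cU := scaled _ cD.
have cL : expR (- log_distance astar p q) * h q @[p --> F] --> h q.
  by apply: scaled; rewrite -oppr0; exact: cvgN.
apply: (squeeze_cvgr _ cL cU); near=> p.
have xp : 0 < xcoord p by near: p; exact: (cvgr_gt _ cx).
have yp : 0 < ycoord p by near: p; exact: (cvgr_gt _ cy).
rewrite /= density_unit_ratio// andbT expRN mulrC ler_pdivrMr ?expR_gt0// mulrC.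
rewrite (_ : log_distance astar p q = log_distance astar q p) ?density_unit_ratio//.
by rewrite /log_distance distrC [X in _ + _ * X]distrC.
Unshelve. all: by end_near. Qed.

Lemma density_unit_continuous q : 0 < xcoord q -> 0 < ycoord q ->
  {for q, continuous (density mu (fun _ _ => 1))}.
Proof.
move=> xq yq; apply: (@cvg_density_unit (nbhs q)) => //.
- exact: (@continuous_xcoord q).
- exact: (@continuous_ycoord q).
Qed.

(** Supplies an actual coefficient for each measure, without which the non-determination claims
    would have no witnesses. *)
Lemma admissible_unit (eps : R) (V : set 'rV[R]_k) :
  admissible eps V mu (fun _ _ => 1).
Proof.
split; first exact: measurable_cst.
- by [].
- by exists 1, 1; split=> //; apply: aeW => a _ p _; rewrite lexx.
- move=> p [/andP[xp _] /andP[yp _] _].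
  by split; [exact: density_unit_continuous|exact: density_unit_gt0].
Qed.

End unit_coefficient.
End density.

(** * Speed of the radial curve and monomials along it *)

Section radial_curve.
Context {R : realType} {k : nat}.
Implicit Types (w a astar : R * R) (beta : R) (z : 'rV[R]_k).

Lemma derivable_chart_point (f g : R -> R) z (r df dg : R) :
  is_derive r 1 f df -> is_derive r 1 g dg ->
  derive1 (fun t => chart_point (f t) (g t) z) r = chart_point df dg 0.
Proof.
move=> fd gd; set gam := (fun t => _).
have entry (i : 'I_1) (j : 'I_(2 + k)) :
    is_derive r 1 (fun t => gam t i j) (chart_point df dg 0 i j).
  rewrite /gam /chart_point; case: (split_ordP j) => j' ->.
    rewrite row_mxEl mxE; under eq_fun do rewrite row_mxEl mxE.
    by case: ifP.
  rewrite row_mxEr mxE (_ : (fun t => _) = cst (z i j')); first exact: is_derive_cst.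
  by apply/funext => t; rewrite row_mxEr.
rewrite derive1E derive_mx; last by apply/derivable_mxP => i j; case: (entry i j).
by apply/matrixP => i j; rewrite mxE; case: (entry i j).
Qed.

Lemma gform_scale n (c : R) (G : 'M[R]_n) v : gform (c *: G) v = c * gform G v.
Proof. by rewrite /gform -scalemxAr -scalemxAl mxE. Qed.

Lemma gform1_chart_point (x y : R) :
  gform 1%:M (chart_point x y (0 : 'rV[R]_k)) = x ^+ 2 + y ^+ 2.
Proof.
rewrite /gform mulmx1 mxE big_split_ord/= [X in _ + X]big1 ?addr0; last first.
  by move=> i _; rewrite {1}/chart_point row_mxEr mxE mul0r.
by rewrite !big_ord_recl big_ord0 addr0 ![_^T _ _]mxE /chart_point !row_mxEl !mxE.
Qed.

(** The factor [r ^+ 2] turns each squared component into [s ^+ 2 * expR (2 * s * ln r)] with [s] a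
    weight. As [ln r < 0], the smaller weight gives the larger exponential. *)
Lemma radial_speed2 w (r : R) : 0 < w.1 -> 0 < w.2 -> 0 < r < 1 ->
  min_weight w ^+ 2 * expR (2 * min_weight w * ln r) <=
    ((w.1 * r `^ (w.1 - 1)) ^+ 2 + (w.2 * r `^ (w.2 - 1)) ^+ 2) * r ^+ 2 <=
  (w.1 ^+ 2 + w.2 ^+ 2) * expR (2 * min_weight w * ln r).
Proof.
move=> w1 w2 /andP[r0 r1]; have lnr : ln r < 0 by rewrite ln_lt0// r0.
have E (s : R) : (s * r `^ (s - 1)) ^+ 2 * r ^+ 2 = s ^+ 2 * expR (2 * s * ln r).
  have h : r `^ (s - 1) * r = expR (s * ln r).
    by rewrite -[X in _ * X](lnK (x := r)) ?posrE// /powR gt_eqF// -expRD; congr expR; ring.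
  have -> : expR (2 * s * ln r) = expR (s * ln r) ^+ 2.
    by rewrite expr2 -expRD; congr expR; ring.
  by rewrite -h; ring.
rewrite [X in _ <= X <= _](mulrDl _ _ (r ^+ 2)) !E /min_weight.
case: (leP w.1 w.2) => h; apply/andP; split.
- by rewrite lerDl mulr_ge0 ?expR_ge0 ?sqr_ge0.
- rewrite [leRHS]mulrDl lerD2l ler_wpM2l ?sqr_ge0// ler_expR ler_nM2r//; nra.
- by rewrite lerDr mulr_ge0 ?expR_ge0 ?sqr_ge0.
- rewrite [leRHS]mulrDl lerD2r ler_wpM2l ?sqr_ge0// ler_expR ler_nM2r//; nra.
Qed.

(** The logarithms of the coordinates are [w.1 * ln r] and [w.2 * ln r], so the monomial is
    [expR (- (ln r * dot w a))], and criticality gives [dot w a] as [2 * min_weight w - 2 ^- n]. *)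
Lemma monomial_radial_curve w astar z (r : R) n : dot w w != 0 ->
  0 < r -> dot w astar = 2 * min_weight w ->
  let p := radial_curve w z r in
  let a := alpha_seq w astar n in
  xcoord p `^ (- a.1) * ycoord p `^ (- a.2) =
  expR (- (2 * min_weight w * ln r)) * expR (ln r * 2 ^- n).
Proof.
move=> ww r0 crit p a; rewrite /p xcoord_chart_point ycoord_chart_point.
rewrite monomialE ?powR_gt0// -expRD !ln_powR; congr expR.
have := dot_alpha_seq astar n ww; rewrite crit -/a /dot => h.
rewrite (_ : _ + _ = ln r * (w.1 * a.1 + w.2 * a.2)); last by ring.
by rewrite h; ring.
Qed.

End radial_curve.

(** * Series bounds for the density with an arbitrary admissible coefficient *)

Section admissible_density.
Context {R : realType} {k : nat}.
Variables (w astar : R * R) (beta eps : R) (V : set 'rV[R]_k).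
Variable u : R * R -> 'rV[R]_(2 + k) -> R.
Hypothesis b0 : 0 < beta.
Let mu := mu_beta w astar beta.
Hypothesis admu : admissible eps V mu u.

Let mono (p : 'rV[R]_(2 + k)) a := xcoord p `^ (- a.1) * ycoord p `^ (- a.2).

Lemma density_mu_betaE p : chart_interior eps V p ->
  ((density mu u p)%:E = (geom_mass beta)^-1%:E *
    \sum_(n <oo) (geom_weight beta n.+1 *
      (u (alpha_seq w astar n.+1) p * mono p (alpha_seq w astar n.+1)))%:E)%E.
Proof.
move=> ip; have [_ u0 _ /(_ _ ip)[_]] := admu.
rewrite /density /Rintegral msupport_mu_beta// => d0.
(* [fine] sends both infinities to 0, so the positivity contained in admissibility forces the
   integral to be finite. *)
rewrite fineK; last by move: d0; case: (integral _ _ _) => //=; rewrite ltxx.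
rewrite ge0_integral_mu_beta// => a Ea.
rewrite lee_fin mulr_ge0 ?mulr_ge0 ?powR_ge0// ltW// u0//.
by rewrite msupport_mu_beta.
Qed.

Lemma density_bounds : exists cu Cu : R, [/\ 0 < cu, 0 < Cu,
    forall p n, chart_interior eps V p ->
      cu * (geom_weight beta n.+1 * mono p (alpha_seq w astar n.+1)) <= density mu u p
  & forall p (M : R), chart_interior eps V p ->
      (\sum_(n <oo) (geom_weight beta n.+1 *
         mono p (alpha_seq w astar n.+1))%:E <= M%:E)%E ->
      density mu u p <= Cu * M].
Proof.
have [_ u0 [cu [Cu [cu0 uae]]] _] := admu.
have ub n p : chart_interior eps V p -> cu <= u (alpha_seq w astar n.+1) p <= Cu.
  move=> ip; have /= := mu_beta_ae n b0 uae; apply => //.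
  by rewrite msupport_mu_beta//; exact: alpha_seq_exponent_set.
(* The maximum with 1 makes the upper constant positive without evaluating [u] at a point of the
   chart. *)
pose Cu' := Num.max 1 Cu; have Cu'0 : 0 < Cu' by rewrite lt_max ltr01.
have Z0 : 0 < (geom_mass beta)^-1 by rewrite invr_gt0 geom_mass_gt0.
have mono0 p a : 0 <= mono p a by rewrite mulr_ge0 ?powR_ge0.
have gw0 n : 0 <= geom_weight beta n := geom_weight_ge0 beta n.
exists (cu * (geom_mass beta)^-1), (Cu' * (geom_mass beta)^-1); split.
- exact: mulr_gt0.
- exact: mulr_gt0.
- move=> p n ip; rewrite -lee_fin density_mu_betaE//.
  rewrite (mulrC cu) -mulrA EFinM lee_pmul2l//.
  have v0 i : 0 <= u (alpha_seq w astar i.+1) p.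
    by have /andP[+ _] := ub i _ ip; apply: le_trans; exact: ltW.
  apply: le_trans (nneseries_lim_ge n.+1 _); last first.
    by move=> i _ _; rewrite lee_fin mulr_ge0// mulr_ge0.
  rewrite big_nat_recr//=.
  apply: (@le_trans _ _ (geom_weight beta n.+1 *
      (u (alpha_seq w astar n.+1) p * mono p (alpha_seq w astar n.+1)))%:E).
    rewrite lee_fin mulrCA ler_wpM2l// ler_wpM2r//.
    by have /andP[] := ub n _ ip.
  by rewrite leeDr// sume_ge0// => i _; rewrite lee_fin mulr_ge0// mulr_ge0.
- move=> p M ip HM; rewrite -lee_fin density_mu_betaE// (mulrC Cu') -mulrA EFinM.
  rewrite lee_pmul2l// EFinM.
  have v0 i : 0 <= u (alpha_seq w astar i.+1) p.
    by have /andP[+ _] := ub i _ ip; apply: le_trans; exact: ltW.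
  apply: (@le_trans _ _ (Cu'%:E * \sum_(n <oo) (geom_weight beta n.+1 *
      mono p (alpha_seq w astar n.+1))%:E)%E); last first.
    by rewrite lee_pmul2l.
  rewrite -nneseriesZl => [|i _]; last by rewrite lee_fin mulr_ge0.
  apply: lee_nneseries => [i _ _|i _].
    by rewrite lee_fin mulr_ge0// mulr_ge0.
  rewrite -EFinM lee_fin [leRHS]mulrCA ler_wpM2l// ler_wpM2r//.
  by have /andP[_ h] := ub i _ ip; rewrite le_max h orbT.
Qed.

End admissible_density.

(** * Logarithmic integrals near 0 *)

Section radial_integrals.
Context {R : realType}.
Notation mu := (@lebesgue_measure R).

(** Derivability at the endpoints included yields the continuity of [f] and the one-sided limits of
    [F] that the fundamental theorem of calculus asks for. *)
Lemma derivable_integral_itvcc (f F : R -> R) (a b : R) : a < b ->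
  (forall x : R, x \in `[a, b] -> derivable f x 1) ->
  (forall x : R, x \in `[a, b] -> is_derive x 1 F (f x)) ->
  (\int[mu]_(x in `[a, b]) (f x)%:E = (F b - F a)%:E)%E.
Proof.
move=> ab df dF; rewrite EFinB; apply: continuous_FTC2 => //.
- exact: derivable_within_continuous.
- have cF x : x \in `[a, b] -> F z @[z --> x] --> F x.
    move=> xab; apply: (@differentiable_continuous _ R^o R^o).
    by apply/derivable1_diffP; exact: (@ex_derive _ _ _ _ _ _ _ (dF x xab)).
  split.
  + move=> x /subset_itv_oo_cc xab; exact: (@ex_derive _ _ _ _ _ _ _ (dF x xab)).
  + by apply: cvg_at_right_filter; apply: cF; rewrite in_itv/= lexx ltW.
  + by apply: cvg_at_left_filter; apply: cF; rewrite in_itv/= lexx ltW.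
- move=> x /subset_itv_oo_cc xab.
  by rewrite derive1E; exact: (@derive_val _ _ _ _ _ _ _ (dF x xab)).
Qed.

Lemma is_derive_Nln (r : R) : 0 < r -> is_derive r 1 (fun t => - ln t) (- r^-1).
Proof. by move=> r0; apply: is_deriveN; exact: is_derive1_ln. Qed.

Lemma Nln_gt0 (r : R) : 0 < r < 1 -> 0 < - ln r.
Proof. by move=> r01; rewrite oppr_gt0 ln_lt0. Qed.

Lemma is_derive_NlnX (s r : R) : 0 < r < 1 ->
  is_derive r 1 (fun t => (- ln t) `^ s) (s * (- ln r) `^ (s - 1) * - r^-1).
Proof.
move=> r01; have r0 : 0 < r by case/andP: r01.
apply: (@is_derive1_comp _ (fun t => t `^ s) (fun t => - ln t)).
  by apply: is_derive1_powR; exact: Nln_gt0.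
exact: is_derive_Nln.
Qed.

Lemma derivable_NlnX_inv (s r : R) : 0 < r < 1 ->
  derivable (fun t => (- ln t) `^ s * t^-1) r 1.
Proof.
move=> r01; apply: derivableM.
  exact: (@ex_derive _ _ _ _ _ _ _ (is_derive_NlnX s r01)).
by apply: derivableV => //; case/andP: r01 => r0 _; rewrite gt_eqF.
Qed.

Lemma measurable_NlnX_inv (s a b : R) : 0 < a -> b < 1 ->
  measurable_fun `[a, b] (fun r : R => (- ln r) `^ s * r^-1).
Proof.
move=> a0 b1; apply: subspace_continuous_measurable_fun => //.
apply: derivable_within_continuous => x; rewrite in_itv/= => /andP[ax xb].
by apply: derivable_NlnX_inv; rewrite (lt_le_trans a0 ax) (le_lt_trans xb b1).
Qed.

(** The antiderivative is [- ln (- ln r)]. *)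
Lemma integral_inv_Nln (a b : R) : 0 < a -> a < b -> b < 1 ->
  (\int[mu]_(r in `[a, b]) ((- ln r) `^ (-1) * r^-1)%:E =
   (ln (- ln a) - ln (- ln b))%:E)%E.
Proof.
move=> a0 ab b1.
have sub x : x \in `[a, b] -> 0 < x < 1.
  rewrite in_itv/= => /andP[ax xb].
  by rewrite (lt_le_trans a0 ax) (le_lt_trans xb b1).
have df x : x \in `[a, b] -> derivable (fun t => (- ln t) `^ (-1) * t^-1) x 1.
  by move=> /sub x01; exact: derivable_NlnX_inv.
have dF x : x \in `[a, b] ->
    is_derive x (1 : R) (fun t => - ln (- ln t)) ((- ln x) `^ (-1) * x^-1).
  move=> /sub x01; have Lx := Nln_gt0 x01; have /andP[x0 _] := x01.
  apply: is_derive_eq.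
    apply: is_deriveN; apply: (@is_derive1_comp _ (@ln R) (fun t => - ln t)).
      exact: is_derive1_ln.
    exact: is_derive_Nln.
  by rewrite mulrN opprK powR_inv1// ltW.
by rewrite (derivable_integral_itvcc ab df dF) opprK addrC.
Qed.

Lemma integral_NlnX (s a b : R) : 1 < s -> 0 < a -> a < b -> b < 1 ->
  (\int[mu]_(r in `[a, b]) ((- ln r) `^ (- s) * r^-1)%:E =
   ((s - 1)^-1 * (- ln b) `^ (1 - s) - (s - 1)^-1 * (- ln a) `^ (1 - s))%:E)%E.
Proof.
move=> s1 a0 ab b1.
have sub x : x \in `[a, b] -> 0 < x < 1.
  rewrite in_itv/= => /andP[ax xb].
  by rewrite (lt_le_trans a0 ax) (le_lt_trans xb b1).
have df x : x \in `[a, b] -> derivable (fun t => (- ln t) `^ (- s) * t^-1) x 1.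
  by move=> /sub x01; exact: derivable_NlnX_inv.
have dF x : x \in `[a, b] ->
    is_derive x (1 : R) (fun t => (s - 1)^-1 * (- ln t) `^ (1 - s))
      ((- ln x) `^ (- s) * x^-1).
  move=> /sub x01; apply: is_derive_eq.
    exact: (is_deriveZ (s - 1)^-1 (is_derive_NlnX (1 - s) x01)).
  rewrite (_ : 1 - s - 1 = - s); last by ring.
  rewrite /GRing.scale/=; field; rewrite subr_eq0 (gt_eqF s1)/=.
  by case/andP: x01 => x0 _; rewrite gt_eqF.
by rewrite (derivable_integral_itvcc ab df dF).
Qed.

(** With [P x = expR (- expR x)] the iterated logarithm [ln (- ln (P x))] is [x], so the integral
    over [[P B, P A]] is [c * (B - A)], and [B - A] can be any positive integer. *)
Lemma integral_inv_Nln_oo (c b : R) : 0 < c -> 0 < b < 1 ->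
  (\int[mu]_(r in `]0%R, b[) (c * ((- ln r) `^ (-1) * r^-1))%:E = +oo)%E.
Proof.
move=> c0 /andP[b0 b1].
set I := integral _ _ _; suff h n : ((c * n.+1%:R)%:E <= I)%E.
  move: h; case: I => [x| |]// h; last by have := h 0%N.
  have := h (Num.truncn (`|x| / c)); rewrite lee_fin leNgt => /negP[].
  apply: (le_lt_trans (ler_norm x)); rewrite mulrC -ltr_pdivrMr//.
  by have /andP[] := @truncn_itv _ (`|x| / c) (divr_ge0 (normr_ge0 _) (ltW c0)).
(* From [expR A >= 1 + A = 2 - ln b] it follows that [P A < b], so the test intervals lie inside the
   domain. *)
pose A : R := 1 - ln b; pose P (x : R) := expR (- expR x).
have P01 x : 0 < P x < 1 by rewrite expR_gt0/= -[ltRHS]expR0 ltr_expR oppr_lt0 expR_gt0.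
have lnP x : ln (- ln (P x)) = x by rewrite /P expRK opprK expRK.
have PA : P A < b.
  rewrite -[ltRHS]lnK ?posrE// ltr_expR ltrNl.
  by apply: lt_le_trans (expR_ge1Dx _); rewrite /A; lra.
have ltP (x y : R) : x < y -> P y < P x by move=> xy; rewrite ltr_expR ltrN2 ltr_expR.
pose B : R := A + n.+1%:R; have AB : A < B by rewrite ltrDl.
have BA : B - A = n.+1%:R by rewrite /B addrAC subrr add0r.
have /andP[PA0 PA1] := P01 A; have /andP[PS0 _] := P01 B.
have pos (r : R) : P B <= r -> 0 <= (- ln r) `^ (-1) * r^-1.
  by move=> h; rewrite mulr_ge0 ?powR_ge0// invr_ge0 ltW// (lt_le_trans PS0).
have le1 : ((c * n.+1%:R)%:E <=
    \int[mu]_(r in `[P B, P A]) (c%:E * ((- ln r) `^ (-1) * r^-1)%R%:E))%E.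
  rewrite ge0_integralZl//=.
  - by rewrite (integral_inv_Nln PS0 (ltP _ _ AB) PA1) (lnP A) (lnP B) -EFinM BA.
  - by apply/measurable_EFinP; exact: measurable_NlnX_inv.
  - by move=> r; rewrite in_itv/= => /andP[/pos h _]; rewrite lee_fin.
  - by rewrite lee_fin ltW.
apply: (le_trans le1); rewrite /I.
apply: ge0_le_subset_integral => r; rewrite ?in_itv/= ?in_itv/=.
- by move=> /andP[h1 h2]; rewrite (lt_le_trans PS0)//= (le_lt_trans h2).
- by move=> /andP[/pos h _]; rewrite mule_ge0// lee_fin// ltW.
- move=> /andP[r0 _]; rewrite lee_fin mulr_ge0 ?(ltW c0)//.
  by rewrite mulr_ge0 ?powR_ge0// invr_ge0 ltW.
- by move=> _; rewrite -EFinM.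
Qed.

(** The domain is exhausted by the intervals [F n]. The primitive at the lower endpoint enters with
    a minus sign, so [M], its value at [b] times [c], bounds all the integrals. *)
Lemma integral_NlnX_lty (c s b : R) : 0 <= c -> 1 < s -> 0 < b < 1 ->
  (\int[mu]_(r in `]0%R, b[) (c * ((- ln r) `^ (- s) * r^-1))%:E < +oo)%E.
Proof.
move=> c0 s1 /andP[b0 b1].
pose f (r : R) := (- ln r) `^ (- s) * r^-1.
have f0 r : 0 < r -> 0 <= c * f r.
  by move=> r0; rewrite mulr_ge0// mulr_ge0 ?powR_ge0// invr_ge0 ltW.
(* The denominator starts at 2 so that [a n < b] already for [n = 0]. *)
pose a n := b / n.+2%:R; pose F n := `[a n, b]%classic.
have a0 n : 0 < a n by rewrite divr_gt0.
have ab n : a n < b by rewrite ltr_pdivrMr// ltr_pMr// ltr1n.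
pose M := c * ((s - 1)^-1 * (- ln b) `^ (1 - s)).
have FM n : (\int[mu]_(r in F n) (c * f r)%:E <= M%:E)%E.
  under eq_integral do rewrite EFinM.
  rewrite /F ge0_integralZl//=.
  - rewrite integral_NlnX// -EFinM lee_fin ler_wpM2l// gerBl.
    by rewrite mulr_ge0 ?powR_ge0// invr_ge0 subr_ge0 ltW.
  - by apply/measurable_EFinP; exact: measurable_NlnX_inv.
  - move=> r; rewrite in_itv/= => /andP[h _]; rewrite lee_fin.
    by rewrite mulr_ge0 ?powR_ge0// invr_ge0 ltW// (lt_le_trans (a0 n)).
have cvF : (\int[mu]_(r in F i) (c * f r)%:E)%E @[i --> \oo] -->
    (\int[mu]_(r in \bigcup_i F i) (c * f r)%:E)%E.
  apply: ge0_nondecreasing_set_cvg_integral.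
  - move=> m n mn; apply/subsetPset => r; rewrite /F /= !in_itv/= => /andP[h ->].
    rewrite andbT (le_trans _ h)// ler_pM2l// lef_pV2 ?posrE// ler_nat.
    by rewrite !ltnS.
  - by move=> i; exact: measurable_itv.
  - move=> i; apply/measurable_EFinP; apply: measurable_funM => //.
    exact: measurable_NlnX_inv.
  - move=> i r; rewrite /F /= in_itv/= => /andP[h _]; rewrite lee_fin f0//.
    exact: lt_le_trans (a0 i) h.
apply: (@le_lt_trans _ _ M%:E); last exact: ltry.
apply: (@le_trans _ _ (\int[mu]_(r in \bigcup_i F i) (c * f r)%:E)%E).
  apply: ge0_le_subset_integral => r; rewrite /= ?in_itv/=.
  - move=> /andP[r0 rb]; exists (Num.truncn (b / r)) => //=.
    rewrite /F /= in_itv/= (ltW rb) andbT /a ler_pdivrMr// mulrC -ler_pdivrMr//.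
    have /andP[_ /ltW h] := @truncn_itv _ (b / r) (divr_ge0 (ltW b0) (ltW r0)).
    by rewrite (le_trans h)// ler_nat.
  - by move=> /andP[r0 _]; rewrite lee_fin f0.
  - move=> [i _]; rewrite /F /= in_itv/= => /andP[h _]; rewrite lee_fin f0//.
    exact: lt_le_trans (a0 i) h.
  - by [].
rewrite -(cvg_lim _ cvF)//; apply: lime_le; first by apply/cvg_ex; eexists; exact: cvF.
exact: nearW.
Qed.

End radial_integrals.

(** * Upper and lower bounds for the weighted exponential sum *)

Section weighted_exponential_sum.
Context {R : realType}.
Implicit Types (beta s t L : R).

Lemma expRN_le_powR s t : 0 < s -> 0 < t ->
  expR (- t) <= expR (s * ln s - s) * t `^ (- s).
Proof.
move=> s0 t0; rewrite /powR (gt_eqF t0) -expRD ler_expR.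
have /le_ln1Dx : -1 < t / s - 1 by rewrite ltrBrDr addNr divr_gt0.
rewrite addrCA subrr addr0 ln_div ?posrE// => h.
have : s * (ln t - ln s) <= t - s.
  rewrite [leRHS](_ : _ = s * (t / s - 1)) ?ler_pM2l//.
  by rewrite mulrBr mulr1 mulrC divfK// gt_eqF.
lra.
Qed.

Lemma geom_weight_expR_le beta s L : 0 < s -> 0 < L -> forall n : nat,
  geom_weight beta n * expR (- (L * 2 ^- n)) <=
  expR (s * ln s - s) * L `^ (- s) * geom_weight (beta - s) n.
Proof.
move=> s0 L0 n.
have t0 : 0 < L * 2 ^- n by rewrite mulr_gt0// invr_gt0 exprn_gt0.
rewrite mulrC (_ : geom_weight (beta - s) n =
    (2 ^- n) `^ (- s) * geom_weight beta n); last first.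
  rewrite -powR_invn// -powRrM -powRD ?pnatr_eq0 ?implybT//.
  by congr (_ `^ _); ring.
rewrite mulrA -[X in _ <= X * _]mulrA -powRM ?(ltW L0) ?invr_ge0 ?exprn_ge0//.
by rewrite ler_wpM2r ?geom_weight_ge0// expRN_le_powR.
Qed.

Lemma weighted_expR_series_le beta s L : 0 < s -> s < beta -> 0 < L ->
  (\sum_(n <oo) (geom_weight beta n.+1 * expR (- (L * 2 ^- n.+1)))%:E <=
   (expR (s * ln s - s) * L `^ (- s) * geom_mass (beta - s))%:E)%E.
Proof.
move=> s0 sb L0; rewrite EFinM geom_massE ?subr_gt0//.
rewrite -nneseriesZl => [|n _]; last by rewrite lee_fin geom_weight_ge0.
apply: lee_nneseries => [n _ _|n _].
  by rewrite lee_fin mulr_ge0 ?geom_weight_ge0 ?expR_ge0.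
by rewrite -EFinM lee_fin geom_weight_expR_le.
Qed.

(* The index is chosen so that 2 ^ n.+1 <= L < 2 ^ n.+2. *)
Lemma exists_weighted_expR_ge beta L : 0 < beta -> beta <= 2 -> 2 <= L ->
  exists n, expR (-2) * (L `^ (-1)) ^+ 2 <=
    geom_weight beta n.+1 * expR (- (L * 2 ^- n.+1)).
Proof.
move=> b0 b2 L2; have L0 : 0 < L by rewrite (lt_le_trans _ L2).
have /andP[NL LN] := truncn_itv (ltW L0); set N := Num.truncn L in NL LN.
have N2 : (2 <= N)%N by rewrite truncn_ge_nat// ltW.
have := @trunc_log_bounds 2 N isT (leq_trans _ N2) => /(_ isT).
case En : (trunc_log 2 N) => [|n] /andP[lo hi].
  by move: hi; rewrite ltnNge N2.
exists n; rewrite mulrC; apply: ler_pM; rewrite ?expR_ge0 ?exprn_ge0 ?powR_ge0//.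
  have Ln : 2 ^+ n.+1 <= L by apply: le_trans NL; rewrite -natrX ler_nat.
  rewrite powR_inv1 ?(ltW L0)// exprVn.
  apply: (@le_trans _ _ ((2 ^+ n.+1 : R) ^- 2)).
    by rewrite lef_pV2 ?posrE ?exprn_gt0// ler_pXn2r ?nnegrE ?exprn_ge0 ?(ltW L0).
  rewrite -exprM -powR_invn// ler_powR ?ler1n// lerN2 natrM mulrC.
  by rewrite ler_wpM2l.
rewrite ler_expR lerN2 ler_pdivrMr ?exprn_gt0//.
rewrite -exprS ltW// (lt_le_trans LN)// -natrX ler_nat.
exact: hi.
Qed.

End weighted_exponential_sum.

(** * Divergence and convergence of the weighted radial length *)

Section radial_length.
Context {R : realType} {k : nat}.
Variables (V : set 'rV[R]_k) (eps : R) (g0 : 'rV[R]_(2 + k) -> 'M[R]_(2 + k)).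
Variables (c0 C0 : R) (z0 : 'rV[R]_k) (w astar : R * R) (r0 beta : R).
Variable u : R * R -> 'rV[R]_(2 + k) -> R.
Hypotheses (Vz0 : V z0) (c0_gt0 : 0 < c0) (c0C0 : c0 <= C0).
Hypothesis ge_g0 :
  metric_le (corner_chart eps V) (fun p => c0 *: euclidean_metric p) g0.
Hypothesis le_g0 :
  metric_le (corner_chart eps V) g0 (fun p => C0 *: euclidean_metric p).
Hypotheses (w1 : 0 < w.1) (w2 : 0 < w.2) (r01 : 0 < r0 < 1).
Hypotheses (r0w1 : r0 `^ w.1 < eps) (r0w2 : r0 `^ w.2 < eps).
Hypothesis crit : dot w astar = 2 * min_weight w.
Hypothesis beta_gt0 : 0 < beta.

Let mu := mu_beta w astar beta.
Hypothesis admu : admissible eps V mu u.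

Let gam := radial_curve w z0.
Let speed2 r := gform (weighted_metric mu u g0 (gam r)) (derive1 gam r).

Let m_gt0 : 0 < min_weight w.
Proof. by rewrite lt_min w1 w2. Qed.

Let ww : dot w w != 0.
Proof. by rewrite gt_eqF// dot_self_gt0. Qed.

Lemma radial_curve_interior r : 0 < r < r0 -> chart_interior eps V (gam r).
Proof.
move=> /andP[r_gt0 rr0].
rewrite /gam /chart_interior /= xcoord_chart_point ycoord_chart_point.
rewrite zcoord_chart_point !powR_gt0//=; split => //.
  by apply: lt_trans r0w1; apply: gt0_ltr_powR; rewrite ?nnegrE ?ltW// (lt_trans r_gt0).
by apply: lt_trans r0w2; apply: gt0_ltr_powR; rewrite ?nnegrE ?ltW// (lt_trans r_gt0).
Qed.

Lemma chart_interior_corner : chart_interior eps V `<=` corner_chart eps V.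
Proof.
move=> p [/andP[x1 x2] /andP[y1 y2] Vz].
by split=> //; rewrite ltW.
Qed.

Lemma radial_speed2_bounds r : 0 < r < r0 ->
  c0 * min_weight w ^+ 2 * (density mu u (gam r) * expR (2 * min_weight w * ln r) * r^-1 ^+ 2)
    <= speed2 r <=
  C0 * (w.1 ^+ 2 + w.2 ^+ 2) *
    (density mu u (gam r) * expR (2 * min_weight w * ln r) * r^-1 ^+ 2).
Proof.
move=> r0r; have ip := radial_curve_interior r0r.
have [_ _ _ /(_ _ ip)[_ d0]] := admu.
have /andP[r_gt0 rr0] := r0r; have r1 : r < 1 by case/andP: r01 => _; exact: lt_trans.
rewrite /speed2 gform_scale /gam /radial_curve.
rewrite (derivable_chart_point z0 (is_derive1_powR w.1 r_gt0) (is_derive1_powR w.2 r_gt0)).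
set v := chart_point _ _ 0.
have icp := chart_interior_corner ip.
have /andP[lo hi] := @radial_speed2 _ w r w1 w2 (introT andP (conj r_gt0 r1)).
have gv : gform 1%:M v * r ^+ 2 =
    ((w.1 * r `^ (w.1 - 1)) ^+ 2 + (w.2 * r `^ (w.2 - 1)) ^+ 2) * r ^+ 2.
  by rewrite gform1_chart_point.
rewrite -gv in lo hi.
have := ge_g0 v icp; have := le_g0 v icp; rewrite !gform_scale => hC hc.
set D := density _ _ _ in d0 *; set e := expR _ in lo hi *.
set G := gform (g0 _) v in hC hc *; set N := gform 1%:M v in lo hi hC hc.
(* Matches the normalisation by [r ^+ 2] in [radial_speed2]. *)
have NE : N = N * r ^+ 2 * r^-1 ^+ 2.
  by rewrite -mulrA -exprMn mulfV ?gt_eqF// expr1n mulr1.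
have C0_gt0 : 0 < C0 by exact: lt_le_trans c0C0.
apply/andP; split.
- rewrite (_ : _ * _ = D * (c0 * (min_weight w ^+ 2 * e * r^-1 ^+ 2))); last by ring.
  rewrite ler_pM2l//; apply: le_trans hc; rewrite ler_pM2l// [leRHS]NE.
  by rewrite ler_wpM2r// exprn_ge0// invr_ge0 ltW.
- rewrite [leRHS](_ : _ = D * (C0 * ((w.1 ^+ 2 + w.2 ^+ 2) * e * r^-1 ^+ 2))); last by ring.
  rewrite ler_pM2l//; apply: (le_trans hC); rewrite ler_pM2l// [leLHS]NE.
  by rewrite ler_wpM2r// exprn_ge0// invr_ge0 ltW.
Qed.

(** The critical cancellation: [e] is the blow-up common to all monomials and [f] the decay of the
    squared Euclidean speed, and only the square of [y * x] survives, ready for the square root. *)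
Let speed2_factor (c d a y x e f : R) : e * f = 1 ->
  c * (d * a) * (y * x) ^+ 2 = c * (d * (e * (a * y ^+ 2)) * f * x ^+ 2).
Proof.
move=> ef; transitivity (c * (d * a) * (e * f) * (y * x) ^+ 2); last by ring.
by rewrite ef mulr1.
Qed.

Let monomialE_radial r n : 0 < r ->
  xcoord (gam r) `^ (- (alpha_seq w astar n).1) *
    ycoord (gam r) `^ (- (alpha_seq w astar n).2) =
  expR (- (2 * min_weight w * ln r)) * expR (- (- ln r * 2 ^- n)).
Proof.
by move=> r_gt0; rewrite (monomial_radial_curve z0 n ww r_gt0 crit) mulNr opprK.
Qed.

Lemma radial_length_oo : beta <= 2 -> radial_length mu u g0 w z0 r0 = +oo%E.
Proof.
move=> b2; have [cu [Cu [cu0 _ dlo _]]] := density_bounds beta_gt0 admu.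
have /andP[r0_gt0 r0_lt1] := r01.
(* Below [expR (-2)] one has [- ln r >= 2], as [exists_weighted_expR_ge] requires; shrinking the
   domain only lowers the integral. *)
pose b := Num.min r0 (expR (-2)).
have b_gt0 : 0 < b by rewrite lt_min r0_gt0 expR_gt0.
have br0 : b <= r0 by rewrite ge_min lexx.
pose K := c0 * min_weight w ^+ 2 * (cu * expR (-2)).
have K0 : 0 < K by rewrite !mulr_gt0 ?expR_gt0// exprn_gt0.
apply/eqP; rewrite -leye_eq.
rewrite -(@integral_inv_Nln_oo R (Num.sqrt K) b) ?sqrtr_gt0//; last first.
  by rewrite b_gt0 (le_lt_trans br0).
apply: ge0_le_subset_integral => r; rewrite /= !in_itv/=.
- by move=> /andP[-> rb]; exact: lt_le_trans rb br0.
- move=> /andP[r_gt0 _]; rewrite lee_fin mulr_ge0 ?sqrtr_ge0//.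
  by rewrite mulr_ge0 ?powR_ge0// invr_ge0 ltW.
- by move=> _; rewrite lee_fin sqrtr_ge0.
- move=> /andP[r_gt0 rb]; have r0r : 0 < r < r0 by rewrite r_gt0 (lt_le_trans rb).
  have L2 : 2 <= - ln r.
    rewrite lerNr -ler_expR lnK ?posrE// ltW//.
    by move: rb; rewrite lt_min => /andP[].
  have [n hn] := exists_weighted_expR_ge beta_gt0 b2 L2.
  have hd := dlo _ n (radial_curve_interior r0r).
  have /andP[hs _] := radial_speed2_bounds r0r.
  set X := (- ln r) `^ (-1) * r^-1.
  have X0 : 0 <= X by rewrite mulr_ge0 ?powR_ge0// invr_ge0 ltW.
  rewrite lee_fin -[X]ger0_norm// -sqrtr_sqr -sqrtrM ?(ltW K0)//.
  apply: ler_wsqrtr; apply: le_trans hs.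
  set e := expR (- (2 * min_weight w * ln r)); set Y := (- ln r) `^ (-1).
  (* The single atom [n], chosen according to [r], already gives the lower bound on the density. *)
  have lo : cu * (e * (expR (-2) * Y ^+ 2)) <= density mu u (gam r).
    apply: le_trans hd; rewrite monomialE_radial// -/e.
    by rewrite ler_pM2l// [leRHS]mulrCA ler_pM2l ?expR_gt0.
  have eE : e * expR (2 * min_weight w * ln r) = 1 by rewrite /e expRN mulVf// expR_eq0.
  rewrite [leLHS](speed2_factor _ _ _ _ _ eE).
  rewrite ler_wpM2l ?mulr_ge0 ?exprn_ge0 ?(ltW c0_gt0) ?(ltW m_gt0)//.
  by rewrite !ler_wpM2r ?exprn_ge0 ?invr_ge0 ?expR_ge0 ?(ltW r_gt0).
Qed.

Lemma radial_length_lty : 2 < beta -> (radial_length mu u g0 w z0 r0 < +oo)%E.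
Proof.
move=> b2; have [cu [Cu [_ Cu0 _ dhi]]] := density_bounds beta_gt0 admu.
(* The midpoint of 2 and [beta]: [s < beta] makes the series converge, and [s / 2 > 1] makes the
   final integral finite. *)
pose s := (beta + 2) / 2.
have s2 : 2 < s by rewrite /s; lra.
have sb : s < beta by rewrite /s; lra.
have s0 : 0 < s by lra.
pose W := w.1 ^+ 2 + w.2 ^+ 2.
pose A := expR (s * ln s - s) * geom_mass (beta - s).
pose K := C0 * W * (Cu * A).
have W0 : 0 < W by rewrite addr_gt0 ?exprn_gt0.
have A0 : 0 < A by rewrite mulr_gt0 ?expR_gt0// geom_mass_gt0 ?subr_gt0.
have C0_gt0 : 0 < C0 by exact: lt_le_trans c0C0.
have K0 : 0 < K by apply: mulr_gt0; apply: mulr_gt0.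
have s21 : 1 < s / 2 by lra.
apply: le_lt_trans (integral_NlnX_lty (sqrtr_ge0 K) s21 r01).
apply: ge0_le_subset_integral => r; rewrite /= ?in_itv/=.
- by [].
- by move=> _; rewrite lee_fin sqrtr_ge0.
- move=> /andP[r_gt0 _]; rewrite lee_fin mulr_ge0 ?sqrtr_ge0//.
  by rewrite mulr_ge0 ?powR_ge0// invr_ge0 ltW.
- move=> r0r; have /andP[r_gt0 rr0] := r0r.
  have L0 : 0 < - ln r.
    by apply: Nln_gt0; rewrite r_gt0; case/andP: r01 => _; exact: lt_trans.
  set e := expR (- (2 * min_weight w * ln r)).
  have hd := dhi _ (e * (A * (- ln r) `^ (- s))) (radial_curve_interior r0r).
  have {}hd : density mu u (gam r) <= Cu * (e * (A * (- ln r) `^ (- s))).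
    apply: hd; under eq_eseriesr do rewrite monomialE_radial// mulrCA EFinM.
    rewrite nneseriesZl => [|n _]; last first.
      by rewrite lee_fin mulr_ge0 ?geom_weight_ge0 ?expR_ge0.
    rewrite EFinM lee_pmul2l// ?lte_fin ?expR_gt0//.
    apply: le_trans (weighted_expR_series_le s0 sb L0) _.
    by rewrite lee_fin /A mulrAC.
  have /andP[_ hs] := radial_speed2_bounds r0r.
  set X := (- ln r) `^ (- (s / 2)) * r^-1.
  have X0 : 0 <= X by rewrite mulr_ge0 ?powR_ge0// invr_ge0 ltW.
  rewrite lee_fin -[X]ger0_norm// -sqrtr_sqr -sqrtrM ?(ltW K0)//.
  apply: ler_wsqrtr; apply: (le_trans hs).
  set Y := (- ln r) `^ (- (s / 2)) in X0 *.
  have YE : (- ln r) `^ (- s) = Y ^+ 2.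
    by rewrite /Y -powR_mulrn ?powR_ge0// -powRrM mulNr divfK.
  have eE : e * expR (2 * min_weight w * ln r) = 1 by rewrite /e expRN mulVf// expR_eq0.
  rewrite YE in hd; rewrite [leRHS](speed2_factor _ _ _ _ _ eE).
  apply: ler_wpM2l; first exact: ltW (mulr_gt0 C0_gt0 W0).
  apply: ler_wpM2r; first by rewrite exprn_ge0// invr_ge0 ltW.
  by apply: ler_wpM2r; first exact: expR_ge0.
Qed.

End radial_length.

(** A predicate [Phi] on the common value of [inv] would have to hold for [nu] and fail for [mu]. *)
Lemma critical_finiteness_not_determined (R : realType) (k : nat)
    (V : set 'rV[R]_k) (eps : R) (g0 : 'rV[R]_(2 + k) -> 'M[R]_(2 + k))
    (w : R * R) (z0 : 'rV[R]_k) (r0 : R) (T : Type)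
    (inv : {measure set (R * R) -> \bar R} -> T)
    (mu nu : {measure set (R * R) -> \bar R}) (u v : R * R -> 'rV[R]_(2 + k) -> R) :
  exponent_measure mu -> exponent_measure nu ->
  admissible eps V mu u -> admissible eps V nu v ->
  support_function (msupport mu) w = 2 * min_weight w ->
  support_function (msupport nu) w = 2 * min_weight w ->
  inv mu = inv nu ->
  radial_length mu u g0 w z0 r0 = +oo%E ->
  (radial_length nu v g0 w z0 r0 < +oo)%E ->
  ~ determines_critical_finiteness eps V g0 w z0 r0 inv.
Proof.
move=> emu enu amu anu smu snu inv_eq lmu lnu [Phi hPhi].
have /hPhi := anu => /(_ enu snu)[/(_ lnu) + _].
by rewrite -inv_eq => /(hPhi _ _ emu amu smu); rewrite lmu ltxx.
Qed.

Theorem theorem5p6 (R : realType) (k : nat) (V : set 'rV[R]_k) (eps : R)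
    (g0 : 'rV[R]_(2 + k) -> 'M[R]_(2 + k)) (c0 C0 : R) (z0 : 'rV[R]_k)
    (w astar : R * R) (r0 bm bp : R) :
  open V -> V z0 -> 0 < eps ->
  riemannian_metric (corner_chart eps V) g0 ->
  0 < c0 -> c0 <= C0 ->
  metric_le (corner_chart eps V) (fun p => c0 *: euclidean_metric p) g0 ->
  metric_le (corner_chart eps V) g0 (fun p => C0 *: euclidean_metric p) ->
  0 < w.1 -> 0 < w.2 ->
  0 < r0 < 1 -> r0 `^ w.1 < eps -> r0 `^ w.2 < eps ->
  0 < astar.1 -> 0 < astar.2 ->
  dot w astar = 2 * min_weight w ->
  (forall n, (1 <= n)%N -> quadrant (alpha_seq w astar n)) ->
  0 < bm -> bm <= 2 -> 2 < bp ->
  let mum := mu_beta w astar bm in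
  let mup := mu_beta w astar bp in
  let E := exponent_set w astar in
  [/\ [/\ exponent_measure mum, exponent_measure mup, compact E,
          msupport mum = E & msupport mup = E],
      newton_body mum = newton_body mup /\
      support_function (msupport mum) = support_function (msupport mup),
      [/\ exposed_point (newton_body mum) astar,
          exposed_point (newton_body mup) astar,
          mum [set astar] = 0%E & mup [set astar] = 0%E],
      [/\ support_function E w = 2 * min_weight w,
          forall u, admissible eps V mum u ->
            radial_length mum u g0 w z0 r0 = +oo%E
        & forall u, admissible eps V mup u ->
            (radial_length mup u g0 w z0 r0 < +oo)%E]
    & [/\ ~ determines_critical_finiteness eps V g0 w z0 r0 msupport,
          ~ determines_critical_finiteness eps V g0 w z0 r0 newton_body
        & ~ determines_critical_finiteness eps V g0 w z0 r0
              (fun mu => support_function (msupport mu))]].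
Proof.
move=> _ Vz0 _ _ c0_gt0 c0C0 ge_g0 le_g0 w1 w2 r01 r0w1 r0w2 a1 a2 crit quad.
move=> bm0 bm2 bp2 mum mup E.
have bp0 : 0 < bp by exact: lt_trans bp2.
have ww : dot w w != 0 by rewrite gt_eqF// dot_self_gt0.
have sm : msupport mum = E by exact: msupport_mu_beta.
have sp : msupport mup = E by exact: msupport_mu_beta.
have Equad := exponent_set_quadrant a1 a2 quad.
have em : exponent_measure mum by exact: exponent_measure_mu_beta.
have ep : exponent_measure mup by exact: exponent_measure_mu_beta.
have sE : support_function E w = 2 * min_weight w.
  by rewrite support_function_exponent_set.
have cm : support_function (msupport mum) w = 2 * min_weight w by rewrite sm.
have cp : support_function (msupport mup) w = 2 * min_weight w by rewrite sp.
(* The constant coefficient serves as witness for both measures, in the given chart and for the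
   given [g0]. *)
have am := @admissible_unit R k _ _ _ w1 w2 bm0 Equad eps V.
have ap := @admissible_unit R k _ _ _ w1 w2 bp0 Equad eps V.
have len_oo u : admissible eps V mum u -> radial_length mum u g0 w z0 r0 = +oo%E.
  by move=> au; apply: (@radial_length_oo R k V eps g0 c0 C0).
have len_lty u : admissible eps V mup u -> (radial_length mup u g0 w z0 r0 < +oo)%E.
  by move=> au; apply: (@radial_length_lty R k V eps g0 c0 C0).
(* Stated for an arbitrary codomain [T], so that one argument covers sets of exponents, convex
   bodies and support functions. *)
have undetermined T (inv : {measure set (R * R) -> \bar R} -> T) :
    inv mum = inv mup -> ~ determines_critical_finiteness eps V g0 w z0 r0 inv.
  move=> inv_eq; exact: (critical_finiteness_not_determined em ep am ap
    cm cp inv_eq (len_oo _ am) (len_lty _ ap)).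
have mass0 beta : mu_beta w astar beta [set astar] = 0%E.
  by apply: mu_beta_eq0 => n /=; exact: alpha_seq_neq.
have body : newton_body mum = newton_body mup by rewrite /newton_body sm sp.
have exposed : exposed_point (newton_body mum) astar.
  by rewrite /newton_body sm; exact: exposed_point_exponent_set.
have same : support_function (msupport mum) = support_function (msupport mup).
  by rewrite sm sp.
have exposed' : exposed_point (newton_body mup) astar by rewrite -body.
split.
- split; [exact: em|exact: ep|exact: compact_exponent_set|exact: sm|exact: sp].
- exact: (conj body same).
- split; [exact: exposed|exact: exposed'|exact: mass0|exact: mass0].
- split; [exact: sE|exact: len_oo|exact: len_lty].
- split; [exact: (undetermined _ _ (etrans sm (esym sp)))|
          exact: (undetermined _ _ body)|exact: (undetermined _ _ same)].
Qed.
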